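(* Let $H$ be a finite simple graph with $v(H)$ vertices and $e(H)$ edges such that $e(H)>v(H)/2$, and let $\epsilon\in(0,1)$ be fixed. Then there exists $\beta_2>0$ at which the function $\beta_2\mapsto\psi(\epsilon,\beta_2)$ is not (real) analytic, where $$\psi(\epsilon,\beta_2)=\sup\left\{\beta_2 t(H,h)-\frac12\iint_{[0,1]^2}I(h(x,y))\,dx\,dy\;:\;h\text{ a graphon},\ \iint_{[0,1]^2}h(x,y)\,dx\,dy=\epsilon\right\}.$$
   Context: A graphon is a measurable function $h:[0,1]^2\to[0,1]$ with $h(x,y)=h(y,x)$. $I(x)=x\log x+(1-x)\log(1-x)$ on $[0,1]$, with $0\log 0=0$. For a finite simple graph $H$ with vertex set $\{1,\dots,v(H)\}$ and edge set $E(H)$, put $t(H,h)=\int_{[0,1]^{v(H)}}\prod_{\{i,j\}\in E(H)}h(x_i,x_j)\,dx_1\cdots dx_{v(H)}$. *)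

(* Defs.v *)
From HB Require Import structures.
From mathcomp Require Import all_boot all_order all_algebra.
From mathcomp Require Import all_classical all_reals all_analysis.

Set Implicit Arguments.
Unset Strict Implicit.
Unset Printing Implicit Defensive.

Import Order.TTheory GRing.Theory Num.Theory.
Import numFieldNormedType.Exports.

Local Open Scope classical_set_scope.
Local Open Scope ring_scope.

Record sgraph (v : nat) := SGraph {
  adj :> rel 'I_v;
  adj_sym : symmetric adj;
  adj_irrefl : irreflexive adj
}.

(* Each edge {i, j} is represented once, by the pair (i, j) with i < j. *)
Definition edges (v : nat) (H : sgraph v) : {set 'I_v * 'I_v} :=
  [set p : 'I_v * 'I_v | (p.1 < p.2)%N && H p.1 p.2]%SET.

Section TupleLebesgue.
Context {R : realType}.

(* [measurableTypeR R] is the carrier of R with its Borel sigma-algebra, on which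
   [lebesgue_measure] lives. *)
Local Notation bR := (measurableTypeR R).

Definition cons_pair n (p : bR * n.-tuple bR) : n.+1.-tuple bR :=
  [tuple of p.1 :: p.2].

Lemma measurable_cons_pair n :
  measurable_fun [set: bR * n.-tuple bR] (@cons_pair n).
Proof. exact: measurable_cons. Qed.

Definition uncons n (t : n.+1.-tuple bR) : bR * n.-tuple bR :=
  (thead t, [tuple of behead t]).

Lemma measurable_uncons n : measurable_fun [set: n.+1.-tuple bR] (@uncons n).
Proof.
by apply: measurable_fun_pair; [exact: measurable_tnth|exact: measurable_behead].
Qed.

Lemma cons_pairK n : cancel (@cons_pair n) (@uncons n).
Proof.
by case=> x t; rewrite /uncons /cons_pair theadE; congr (_, _); exact: val_inj.
Qed.

Section Step.
Variables (n : nat) (m : {sigma_finite_measure set n.-tuple bR -> \bar R}).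

Definition tuple_lebesgue_step : set (n.+1.-tuple bR) -> \bar R :=
  pushforward (@lebesgue_measure R \x m)%E (@cons_pair n).

Let meas : {measure set n.+1.-tuple bR -> \bar R} :=
  measure_function_pushforward__canonical__measure_function_Measure
    (@lebesgue_measure R \x m)%E (@measurable_cons_pair n).

Let step0 : tuple_lebesgue_step set0 = 0%E.
Proof. exact: (measure0 meas). Qed.

Let step_ge0 A : (0 <= tuple_lebesgue_step A)%E.
Proof. exact: (measure_ge0 meas). Qed.

Let step_sigma_additive : semi_sigma_additive tuple_lebesgue_step.
Proof. exact: (@measure_semi_sigma_additive _ _ _ meas). Qed.

HB.instance Definition _ := isMeasure.Build _ _ _ tuple_lebesgue_step
  step0 step_ge0 step_sigma_additive.

Lemma tuple_lebesgue_step_sigma_finite : sigma_finite setT tuple_lebesgue_step.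
Proof.
have /sigma_finiteP[F [TF ndF Foo]] := sigma_finiteT (@lebesgue_measure R).
have /sigma_finiteP[G [TG ndG Goo]] := sigma_finiteT m.
have FGT : \bigcup_k (F k `*` G k) = setT.
  rewrite predeqE => -[x y]; split=> // _.
  have [i _ Fx] : (\bigcup_i F i) x by rewrite -TF.
  have [j _ Gy] : (\bigcup_j G j) y by rewrite -TG.
  exists (maxn i j) => //; split => /=.
    by move: x Fx; exact/subsetPset/ndF/leq_maxl.
  by move: y Gy; exact/subsetPset/ndG/leq_maxr.
exists (fun k => @uncons n @^-1` (F k `*` G k)).
  by rewrite -preimage_bigcup FGT preimage_setT.
move=> k; have [mF Fk] := Foo k; have [mG Gk] := Goo k; split.
  by rewrite -[X in measurable X]setTI; apply: measurable_uncons => //;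
    exact: measurableX.
rewrite /tuple_lebesgue_step /pushforward -comp_preimage.
rewrite (_ : _ \o _ = id) ?preimage_id; last first.
  by apply/funext => x; exact: cons_pairK.
by rewrite product_measure1E// lte_mul_pinfty// ge0_fin_numE.
Qed.

HB.instance Definition _ := @Measure_isSigmaFinite.Build _ _ _
  tuple_lebesgue_step tuple_lebesgue_step_sigma_finite.

End Step.

(* Lebesgue measure on R^v: the point mass for v = 0, and the image of
   (Lebesgue on R) \x (Lebesgue on R^n) under (x, t) |-> x :: t for v = n.+1. *)
Fixpoint tuple_lebesgue (v : nat) :
    {sigma_finite_measure set v.-tuple bR -> \bar R} :=
  match v with
  | 0 => \d_([tuple of [::]] : 0.-tuple bR)
  | n.+1 => tuple_lebesgue_step (tuple_lebesgue n)
  end.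

End TupleLebesgue.

Section Graphons.
Context {R : realType}.
Local Notation bR := (measurableTypeR R).
Implicit Types (h : bR * bR -> R).

Definition unit_square : set (bR * bR) := `[0, 1] `*` `[0, 1].

Definition unit_cube (v : nat) : set (v.-tuple bR) :=
  [set x | forall i, tnth x i \in `[0, 1]].

(* The values of h outside the unit square are irrelevant. *)
Definition graphon h : Prop :=
  [/\ measurable_fun unit_square h,
      (forall p, unit_square p -> 0 <= h p <= 1) &
      (forall x y, unit_square (x, y) -> h (x, y) = h (y, x))].

Definition square_integral (f : bR * bR -> R) : R :=
  \int[(@lebesgue_measure R \x @lebesgue_measure R)%E]_(p in unit_square) f p.

Definition hom_density (v : nat) (H : sgraph v) h : R :=
  \int[tuple_lebesgue v]_(x in @unit_cube v)
    \prod_(p in edges H) h (tnth x p.1, tnth x p.2).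

(* [ln 0 = 0], so [I_fun 0 = I_fun 1 = 0]. *)
Definition I_fun (x : R) : R := x * ln x + (1 - x) * ln (1 - x).

(* For 0 <= eps <= 1 the set is nonempty and bounded above, so the real-valued
   [sup] is its least upper bound. *)
Definition psi (v : nat) (H : sgraph v) (eps beta2 : R) : R :=
  sup [set beta2 * hom_density H h - 2^-1 * square_integral (I_fun \o h) |
       h in [set h | graphon h /\ square_integral h = eps]].

Definition real_analytic_at (f : R -> R) (x0 : R) : Prop :=
  exists (a : nat -> R) (r : R), 0 < r /\
    forall x, `|x - x0| < r -> pseries a (x - x0) @ \oo --> f x.

End Graphons.

(* Main.v *)
Require Import Defs.
From mathcomp Require Import all_boot all_order all_algebra.
From mathcomp Require Import all_classical all_reals all_analysis.
From mathcomp Require Import measurable_realfun.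
From mathcomp Require Import ring lra.

(** Write n = e(H), and let l(b) = b eps^n - I(eps)/2 be the value of the
constant graphon.

For small b > 0, psi = l: if h has density eps, then expanding the product of
the h(x_i,x_j) around eps gives t(H,h) <= eps^n + K |h - eps|_2^2, because the
linear terms integrate to zero, while the integral of I(h) is at least
I(eps) + |h - eps|_2^2 / 4.

For large b, psi > l: the indicator of [0, sqrt eps]^2 has density eps, zero
entropy and homomorphism density at least (sqrt eps)^v(H), which exceeds
eps^n exactly because n > v(H)/2.

Let s be the supremum of the b such that psi = l on (0, b]. If psi were
analytic at s, then its power series would agree with l to the left of s, hence
have the same coefficients, and psi = l would persist to the right of s. *)

Set Implicit Arguments.
Unset Strict Implicit.
Unset Printing Implicit Defensive.
Import Order.TTheory GRing.Theory Num.Theory.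
Import numFieldNormedType.Exports.
Local Open Scope classical_set_scope.
Local Open Scope ring_scope.

(** * Pointwise inequalities *)

(** Replace the factors by [e] one at a time: the other factors lie in [0,1], so each replacement
    costs at most [|a i - e|]. *)
Lemma dist_prod_exp (R : realFieldType) (I : Type) (s : seq I) (a : I -> R) (e : R) :
  0 <= e <= 1 -> (forall i, 0 <= a i <= 1) ->
  `|\prod_(i <- s) a i - e ^+ size s| <= \sum_(i <- s) `|a i - e|.
Proof.
move=> /andP[e0 e1] a01; elim: s => [|i s ih].
  by rewrite !big_nil /= subrr normr0.
rewrite !big_cons /= exprS.
have -> : a i * \prod_(j <- s) a j - e * e ^+ size s =
  (a i - e) * \prod_(j <- s) a j + e * (\prod_(j <- s) a j - e ^+ size s) by ring.
apply: (le_trans (ler_normD _ _)); rewrite !normrM (ger0_norm e0).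
apply: lerD.
  rewrite ler_piMr//.
  rewrite ger0_norm; last by apply: prodr_ge0 => j _; case/andP: (a01 j).
  by apply: prodr_ile1 => j _.
by apply: le_trans ih; rewrite ler_piMl.
Qed.

Lemma mulr_le_sqrD (R : realFieldType) (x y : R) : x * y <= x ^+ 2 + y ^+ 2.
Proof. have := sqr_ge0 (x - y); have := sqr_ge0 x; have := sqr_ge0 y; nra. Qed.

(** The linear term is kept exactly, because it will integrate to zero under the density constraint.
    In the induction the only new error is [d * (p - e ^+ n)], a product of two first-order
    quantities, controlled by [dist_prod_exp] and [mulr_le_sqrD]. The constant [K] depends on [e]
    and [n] only. *)
Lemma prod_le_second_order (R : realFieldType) (e : R) (n : nat) : 0 <= e <= 1 ->
  exists2 K : R, 0 <= K &
  forall (I : Type) (s : seq I) (a : I -> R), size s = n ->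
    (forall i, 0 <= a i <= 1) ->
    \prod_(i <- s) a i <=
    e ^+ n + e ^+ n.-1 * (\sum_(i <- s) (a i - e)) + K * \sum_(i <- s) (a i - e) ^+ 2.
Proof.
move=> e01; have /andP[e0 e1] := e01; elim: n => [|n [K K0 ih]].
  exists 0 => // I [|//] a _ _; rewrite !big_nil /=; lra.
(* [K] pays for the inductive error, [n] for one copy of [d ^+ 2] per remaining factor, and 1 for
   the extra copy of [Q]. *)
exists (K + n%:R + 1); first by rewrite !addr_ge0.
move=> I [//|i s] a /= [sn] a01; rewrite !big_cons.
have {ih}P := ih I s a sn a01.
have D := dist_prod_exp s e01 a01; rewrite sn in D.
set p := \prod_(j <- s) _ in P D *.
set S := \sum_(j <- s) _ in P *.
set Q := \sum_(j <- s) (_ ^+ _) in P *.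
set d := a i - e.
have Q0 : 0 <= Q by apply: sumr_ge0 => j _; exact: sqr_ge0.
have dp : d * (p - e ^+ n) <= n%:R * d ^+ 2 + Q.
  apply: (le_trans (ler_norm _)); rewrite normrM.
  apply: (le_trans (ler_wpM2l _ D)) => //.
  rewrite mulr_sumr.
  have -> : n%:R * d ^+ 2 + Q = \sum_(j <- s) (d ^+ 2 + (a j - e) ^+ 2).
    by rewrite big_split /= big_const_seq count_predT sn iter_addr_0 mulr_natl.
  apply: ler_sum => j _; rewrite -(real_normK (num_real d)) -(real_normK (num_real (a j - e))).
  exact: mulr_le_sqrD.
(* For [n = 0] the truncated predecessor makes the exponents disagree, but then [S] is an empty
   sum. *)
have eS : e * (e ^+ n.-1 * S) = e ^+ n * S.
  case: n sn {P D K K0 dp} => [|n] sn; last by rewrite mulrA -exprS.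
  by rewrite /S; case: s sn {p S Q Q0} => //; rewrite big_nil !mulr0.
have -> : a i * p = e * p + d * e ^+ n + d * (p - e ^+ n) by rewrite /d; ring.
have eP := ler_wpM2l e0 P.
have eKQ : e * (K * Q) <= K * Q by rewrite ler_piMl// mulr_ge0.
have d2 : 0 <= (K + 1) * d ^+ 2 by rewrite mulr_ge0 ?sqr_ge0// addr_ge0.
have nQ : 0 <= n%:R * Q by rewrite mulr_ge0.
rewrite !mulrDr eS in eP.
clear P D eS; clearbody p S Q d; rewrite exprS; lra.
Qed.

(** * A quadratic lower bound for the entropy *)

Section Entropy.
Context {R : realType}.

(** Write [u * ln (u / e)] as [- 2 * u * ln (sqrt (e / u))] and use [ln z <= z - 1]. Added to its
    instance at [1 - u] and [1 - e], the left side becomes the squared Hellinger distance. *)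
Lemma xlnx_sub_ge (u e : R) : 0 <= u -> 0 < e ->
  2 * u - 2 * (Num.sqrt u * Num.sqrt e) <= u * ln u - u * ln e.
Proof.
rewrite le_eqVlt => /predU1P[<-|u0] e0; first by rewrite sqrtr0; lra.
have su : 0 < Num.sqrt u by rewrite sqrtr_gt0.
have se : 0 < Num.sqrt e by rewrite sqrtr_gt0.
have h : ln (Num.sqrt e / Num.sqrt u) <= Num.sqrt e / Num.sqrt u - 1.
  rewrite -[X in ln X](subrK 1) addrC; apply: le_ln1Dx.
  by rewrite ltrBrDr addrC subrr divr_gt0.
have uE : u = Num.sqrt u ^+ 2 by rewrite sqr_sqrtr// ltW.
have eE : e = Num.sqrt e ^+ 2 by rewrite sqr_sqrtr// ltW.
have lu : ln u = 2 * ln (Num.sqrt u) by rewrite {1}uE lnXn// mulr_natl.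
have le : ln e = 2 * ln (Num.sqrt e) by rewrite {1}eE lnXn// mulr_natl.
move: h; rewrite ln_div// => h.
have -> : u * ln u - u * ln e =
  - (2 * u) * (ln (Num.sqrt e) - ln (Num.sqrt u)).
  by rewrite lu le; ring.
have -> : 2 * u - 2 * (Num.sqrt u * Num.sqrt e) =
   - (2 * u) * (Num.sqrt e / Num.sqrt u - 1).
  have -> : Num.sqrt u * Num.sqrt e = u * (Num.sqrt e / Num.sqrt u).
    by rewrite [X in X * (_ / _)]uE; field; rewrite gt_eqF.
  by ring.
by rewrite ler_wnM2l// oppr_le0; lra.
Qed.

(* Relative entropy dominates the squared Hellinger distance, which dominates
   [(u - e)^2 / 4] since [sqrt u + sqrt e <= 2]. *)
Lemma I_fun_ge (u e : R) : 0 <= u <= 1 -> 0 < e < 1 ->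
  I_fun e + (ln e - ln (1 - e)) * (u - e) + 4^-1 * (u - e) ^+ 2 <= I_fun u.
Proof.
move=> /andP[u0 u1] /andP[e0 e1]; rewrite /I_fun.
have h1 := xlnx_sub_ge u0 e0.
have u1' : 0 <= 1 - u by lra.
have e1' : 0 < 1 - e by lra.
have h2 := xlnx_sub_ge u1' e1'.
have su := sqrtr_ge0 u; have se := sqrtr_ge0 e.
have uE : Num.sqrt u ^+ 2 = u by rewrite sqr_sqrtr.
have eE : Num.sqrt e ^+ 2 = e by rewrite sqr_sqrtr// ltW.
have uE' : Num.sqrt (1 - u) ^+ 2 = 1 - u by rewrite sqr_sqrtr.
have eE' : Num.sqrt (1 - e) ^+ 2 = 1 - e by rewrite sqr_sqrtr// ltW.
have q := sqr_ge0 (Num.sqrt (1 - u) - Num.sqrt (1 - e)).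
have su1 : Num.sqrt u <= 1 by rewrite -[leRHS]sqrtr1 ler_wsqrtr.
have se1 : Num.sqrt e <= 1 by rewrite -[leRHS]sqrtr1 ler_wsqrtr// ltW.
have key : 4^-1 * (u - e) ^+ 2 <= (Num.sqrt u - Num.sqrt e) ^+ 2.
  rewrite -{1}uE -{1}eE subr_sqr exprMn mulrCA ler_piMr ?sqr_ge0//.
  move: su se su1 se1; set s := Num.sqrt u; set t := Num.sqrt e => *; nra.
lra.
Qed.
End Entropy.

(** * One-sided uniqueness of power series *)

Section PowerSeries.
Context {R : realType}.

Lemma pseries_recl (c : nat -> R) (y : R) (N : nat) :
  pseries c y N.+1 = c 0%N + y * pseries (fun k => c k.+1) y N.
Proof.
rewrite /pseries /series /= big_nat_recl// expr0 mulr1 mulr_sumr; congr (_ + _).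
by apply: eq_bigr => k _; rewrite exprS mulrCA.
Qed.

(** Convergence at one negative point bounds the coefficients geometrically. Nearer to 0 the terms
    after the constant one then sum to at most a multiple of the distance, so the constant term is
    arbitrarily small. *)
Lemma pseries_left0_coef0 (c : nat -> R) (r : R) : 0 < r ->
  (forall y : R, - r < y < 0 -> pseries c y @ \oo --> (0 : R)) -> c 0%N = 0.
Proof.
move=> r0 c0; have [rho rho0 rE] : exists2 rho, 0 < rho & r = rho * 2.
  by exists (r / 2); rewrite ?divr_gt0// divfK.
(* The terms of the series converging at [- rho] tend to 0, hence are bounded. *)
have [M M0 cM] : exists2 M, 0 <= M & forall k, `|c k| * rho ^+ k <= M.
  have /cvgP/cvg_series_cvg_0/cvgP/cvg_seq_bounded : pseries c (- rho) @ \oo --> (0:R).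
    by apply: c0; lra.
  move=> [M0 [_ /(_ (`|M0| + 1))]] /=; rewrite (le_lt_trans (ler_norm M0)) ?ltrDl//.
  move=> /(_ isT) h; exists (`|M0| + 1); first by rewrite addr_ge0.
  move=> k; have := h k Logic.I.
  by rewrite normrM normrX normrN (ger0_norm (ltW rho0)).
have ct t : 0 < t <= 2^-1 -> `|c 0%N| <= 2 * M * t.
  move=> /andP[t0 t1].
  have /cvg_norm : pseries c (- (rho * t)) @ \oo --> (0:R).
    have : 0 < rho * t by rewrite mulr_gt0.
    have : rho * t <= rho * 2^-1 by rewrite ler_pM2l.
    by move=> ? ?; apply: c0; lra.
  rewrite normr0 => /(cvgB (cvg_cst (`|c 0%N|))); rewrite subr0 => h.
  apply: (cvgr_to_le h); exists 1%N => // -[//|N] _ /=.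
  rewrite !fctE pseries_recl lerBlDr.
  have -> : c 0%N = (c 0%N + - (rho * t) * pseries (fun k => c k.+1) (- (rho * t)) N)
      + (rho * t) * pseries (fun k => c k.+1) (- (rho * t)) N by ring.
  rewrite {2}mulNr subrK addrC.
  apply: (le_trans (ler_normD _ _)). rewrite lerD2r.
  rewrite /pseries /series /= mulr_sumr.
  apply: (le_trans (ler_norm_sum _ _ _)).
  (* The factor [1 - t ^+ n] makes the induction close, using [2 * t <= 1]. *)
  have geo n : \sum_(0 <= k < n) M * t ^+ k.+1 <= 2 * M * t * (1 - t ^+ n).
    elim: n => [|n ih]; first by rewrite big_geq// expr0 subrr mulr0.
    rewrite big_nat_recr//=; apply: (le_trans (lerD ih (lexx _))).
    rewrite exprS.
    have : 0 <= M * t * t ^+ n * (1 - 2 * t).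
      by rewrite !mulr_ge0 ?exprn_ge0//; lra.
    lra.
  apply: (@le_trans _ _ (\sum_(0 <= k < N) M * t ^+ k.+1)).
    apply: ler_sum => k _; rewrite !normrM normrX normrN normrM.
    rewrite (ger0_norm (ltW t0)) (ger0_norm (ltW rho0)).
    have -> : rho * t * (`|c k.+1| * (rho * t) ^+ k) =
       (`|c k.+1| * rho ^+ k.+1) * t ^+ k.+1 by rewrite exprMn !exprS; ring.
    by rewrite ler_wpM2r// exprn_ge0// ltW.
  apply: (le_trans (geo N)); rewrite ler_piMr//; last first.
    by rewrite lerBlDr lerDl exprn_ge0// ltW.
  by rewrite !mulr_ge0// ltW.
apply/eqP; rewrite -normr_eq0 eq_le normr_ge0 andbT; apply/ler_addgt0Pl => e e0.
rewrite addr0.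
(* This gives [2 * M * t <= e]; the added 1 keeps the denominator positive when [M = 0]. *)
pose t := Num.min (2^-1) (e / (2 * M + 1)).
have M1 : 0 < 2 * M + 1 by rewrite ltr_wpDl// mulr_ge0.
have t0 : 0 < t by rewrite lt_min divr_gt0// invr_gt0 ltr0n.
apply: (le_trans (ct t _)); first by rewrite t0 ge_min lexx.
have : t <= e / (2 * M + 1) by rewrite ge_min lexx orbT.
rewrite ler_pdivlMr//; lra.
Qed.

(** Once the constant coefficient vanishes, dividing by [y], which is nonzero, gives the same
    hypothesis for the shifted coefficients. *)
Lemma pseries_left0_coef (c : nat -> R) (r : R) : 0 < r ->
  (forall y : R, - r < y < 0 -> pseries c y @ \oo --> (0 : R)) -> forall n, c n = 0.
Proof.
move=> r0 + n; elim: n c => [|n ih] c h; first exact: pseries_left0_coef0 h.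
have c00 := pseries_left0_coef0 r0 h.
apply: (ih (fun k => c k.+1)) => y yr.
have y0 : y != 0 by rewrite lt_eqF//; case/andP: yr.
have := h y yr; rewrite -(cvg_shiftS (pseries c y)) => /cvgM /(_ (cvg_cst y^-1)).
rewrite mul0r; apply: cvg_trans; apply: near_eq_cvg; near=> N.
by rewrite /= pseries_recl c00 add0r mulrAC mulfV// mul1r.
Unshelve. all: by end_near. Qed.

(** The coefficients are [d0], [d1], 0, 0, ..., so the partial sums are constant from index 2 on. *)
Lemma pseries_affine (d0 d1 y : R) :
  pseries (fun k => if k is k'.+1 then if k' is _.+1 then 0 else d1 else d0) y
    @ \oo --> d0 + d1 * y.
Proof.
rewrite -(cvg_shiftn 2); apply: cvg_near_cst; apply: nearW => N.
rewrite /= addn2 !pseries_recl /pseries /series /= big1 ?mulr0 ?addr0 1?mulrC//.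
by move=> i _; rewrite mul0r.
Qed.

(** The series of [f] and that of the affine function, recentred at [x0], have the same sum to the
    left of [x0], hence the same coefficients. *)
Lemma analytic_affine_left (f : R -> R) (x0 r p q : R) : 0 < r ->
  real_analytic_at f x0 ->
  (forall x, x0 - r < x < x0 -> f x = p * x + q) ->
  exists2 s, 0 < s & forall x, `|x - x0| < s -> f x = p * x + q.
Proof.
move=> r0 [a [s [s0 af]]] fl; exists s => // x xs.
set d := (fun k => if k is k'.+1 then if k' is _.+1 then 0 else p else p * x0 + q) : nat -> R.
have dl y : pseries d (y - x0) @ \oo --> p * y + q.
  have -> : p * y + q = (p * x0 + q) + p * (y - x0) by ring.
  exact: pseries_affine.
have mrs : 0 < Num.min r s by rewrite lt_min r0.
have ad : forall n, a n - d n = 0.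
  apply: (@pseries_left0_coef (fun n => a n - d n) _ mrs) => y /andP[].
  rewrite -[y in X in X -> _](addrK x0) -[y in X in _ -> X -> _](addrK x0).
  set z := y + x0.
  have -> : y = z - x0 by rewrite /z addrK.
  rewrite ltrNl lt_min => /andP[zr zs] z0.
  have := af z; rewrite ltr0_norm// => /(_ zs).
  rewrite fl; last by lra.
  move=> /cvgB/(_ (dl z)); rewrite subrr; apply: cvg_trans.
  apply: near_eq_cvg; apply: nearW => N.
  rewrite /pseries /series /= !fctE -sumrB; apply: eq_bigr => k _.
  by rewrite mulrBl.
have ead : a = d by apply/funext => n; apply/eqP; rewrite -subr_eq0 ad.
have ax := af x xs; have dx := dl x; rewrite -ead in dx.
exact: (cvg_unique _ ax dx).
Qed.

End PowerSeries.

(** * Boxes and two-dimensional marginals of Lebesgue measure *)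

Section BoxMeasure.
Context {R : realType}.
Local Notation bR := (measurableTypeR R).
Local Notation lam := (@lebesgue_measure R).

Definition box v (A : 'I_v -> set bR) : set (v.-tuple bR) :=
  [set x | forall i, A i (tnth x i)].

Lemma measurable_box v (A : 'I_v -> set bR) :
  (forall i, measurable (A i)) -> measurable (box A).
Proof.
move=> mA; have -> : box A = \bigcap_(i in [set: 'I_v]) ((fun x => tnth x i) @^-1` A i).
  by apply/seteqP; split => x h i; [move=> _|]; exact: h.
apply: fin_bigcap_measurable => // i _.
rewrite -[X in measurable X]setTI; exact: measurable_tnth.
Qed.

(** Peel off the first coordinate, following the recursion of [tuple_lebesgue]. Taking the side
    measures as reals [a i] keeps the product finite. *)
Lemma tuple_lebesgue_box v (A : 'I_v -> set bR) (a : 'I_v -> R) :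
  (forall i, measurable (A i)) -> (forall i, lam (A i) = (a i)%:E) ->
  tuple_lebesgue v (box A) = (\prod_i a i)%:E.
Proof.
elim: v A a => [|v ih] A a mA lA.
  rewrite big_ord0 /= diracE mem_set//.
  by move=> /= -[].
rewrite /= /tuple_lebesgue_step /pushforward.
have -> : @cons_pair _ _ @^-1` box A =
    A ord0 `*` box (fun i : 'I_v => A (lift ord0 i)).
  apply/seteqP; split => [[x t] /= h|[x t] /= [h0 h] i].
    split=> [|i]; first by have := h ord0; rewrite /cons_pair tnth0.
    by have := h (lift ord0 i); rewrite /cons_pair tnthS.
  rewrite /cons_pair; case: (unliftP ord0 i) => [j|] ->; first by rewrite tnthS.
  by rewrite tnth0.
rewrite product_measure1E//; last exact: measurable_box.
by rewrite /= lA (ih _ (fun i => a (lift ord0 i)))// -EFinM big_ord_recl.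
Qed.

Lemma unit_cubeE v : @unit_cube R v = box (fun=> `[0, 1]%classic).
Proof. by []. Qed.

Lemma lebesgue_measure_0b (b : R) : 0 <= b -> lam (`[0, b]%classic : set bR) = b%:E.
Proof.
rewrite le_eqVlt => /predU1P[<-|b0]; first by rewrite set_itv1 lebesgue_measure_set1.
by rewrite lebesgue_measure_itv/= lte_fin b0 -EFinB subr0.
Qed.

Lemma measurable_unit_cube v : measurable (@unit_cube R v).
Proof. by rewrite unit_cubeE; exact: measurable_box. Qed.

Lemma tuple_lebesgue_unit_cube v : tuple_lebesgue v (@unit_cube R v) = 1%:E.
Proof.
rewrite unit_cubeE (@tuple_lebesgue_box _ _ (fun=> 1))// ?big1_eq// => _.
exact: lebesgue_measure_0b.
Qed.

Lemma measurable_unit_square : measurable (@unit_square R).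
Proof. exact: measurableX. Qed.

Lemma measure_unit_square : (lam \x lam)%E (@unit_square R) = 1%:E.
Proof.
by rewrite product_measure1E//= !lebesgue_measure_0b// mul1e.
Qed.

Section Marginal.
Variables (v : nat) (i j : 'I_v) (ij : i != j).

Definition coord_pair (x : v.-tuple bR) : bR * bR := (tnth x i, tnth x j).

Lemma measurable_coord_pair : measurable_fun setT coord_pair.
Proof. by apply: measurable_fun_pair; exact: measurable_tnth. Qed.

Let mu := mrestr (tuple_lebesgue v) (@measurable_unit_cube v).

Let nu : {measure set (bR * bR) -> \bar R} :=
  measure_function_pushforward__canonical__measure_function_Measure
    mu measurable_coord_pair.

Let nuE (C : set (bR * bR)) : nu C = tuple_lebesgue v (coord_pair @^-1` C `&` @unit_cube R v).
Proof. by []. Qed.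

Let rho : {measure set (bR * bR) -> \bar R} :=
  mrestr (lam \x lam)%E measurable_unit_square.

Let fin_lam01 (A : set bR) : measurable A -> lam (A `&` `[0, 1]) \is a fin_num.
Proof.
move=> mA; rewrite ge0_fin_numE//.
apply: (@le_lt_trans _ _ (lam `[0%R, 1%R]%classic)).
  by apply: le_measure => //; rewrite inE//; exact: measurableI.
by rewrite lebesgue_measure_0b// ltry.
Qed.

(** Rectangles generate the product sigma-algebra and are stable under intersection, so agreement on
    them suffices. The preimage of a rectangle in the cube is a box whose sides other than [i] and
    [j] have length 1. *)
Lemma coord_pair_law (C : set (bR * bR)) : measurable C -> nu C = rho C.
Proof.
pose G := [set A `*` B | A in @measurable _ bR & B in @measurable _ bR].
apply: (measure_unique G (fun=> setT)).
- by rewrite measurable_prod_measurableType.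
- move=> _ _ [A mA [B mB <-]] [A' mA' [B' mB' <-]].
  exists (A `&` A'); first exact: measurableI.
  by exists (B `&` B'); [exact: measurableI|rewrite setXI].
- by move=> _; exists setT => //; exists setT => //; rewrite setXTT.
- by rewrite bigcup_const//; exists 0%N.
- move=> _ [A mA [B mB <-]]; rewrite nuE /rho /= /mrestr.
  rewrite /unit_square -setXI product_measure1E//; try exact: measurableI.
  (* Since [i != j], the first branch does not hide [B] at [j]. *)
  pose D k : set bR := if k == i then A else if k == j then B else setT.
  have mD k : measurable (D k `&` `[0, 1]).
    by rewrite /D; apply: measurableI => //; do 2 case: ifP => // _.
  have -> : coord_pair @^-1` (A `*` B) `&` @unit_cube R v = box (fun k => D k `&` `[0, 1]).
    apply/seteqP; split => [x [[/= xA xB] xc] k|x xD].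
      by split; [rewrite /D; case: eqP => [->//|_]; case: eqP => [->//|]|exact: xc].
    split; last by move=> k; case: (xD k).
    split => /=; [have [+ _] := xD i|have [+ _] := xD j].
      by rewrite /D eqxx.
    by rewrite /D eqxx eq_sym (negbTE ij).
  rewrite (@tuple_lebesgue_box _ _ (fun k => fine (lam (D k `&` `[0, 1]))))//; last first.
    move=> k; rewrite fineK// fin_lam01// /D.
    by do 2 case: ifP => // _.
  rewrite (bigD1 i)//= (bigD1 j)/= 1?eq_sym// big1 ?mulr1; last first.
    move=> k /andP[ki kj]; rewrite /D (negbTE ki) (negbTE kj) setTI.
    by rewrite lebesgue_measure_0b.
  rewrite {1}/D eqxx /D eqxx eq_sym (negbTE ij).
  by rewrite EFinM !fineK// fin_lam01.
- move=> _; rewrite nuE preimage_setT setTI.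
  by rewrite tuple_lebesgue_unit_cube ltry.
Qed.

Lemma ge0_integral_coord_pair (f : bR * bR -> \bar R) :
  measurable_fun (@unit_square R) f -> (forall p, unit_square p -> 0 <= f p)%E ->
  (\int[tuple_lebesgue v]_(x in @unit_cube R v) f (tnth x i, tnth x j) =
   \int[lam \x lam]_(p in unit_square) f p)%E.
Proof.
move=> mf f0.
transitivity (\int[nu]_(p in unit_square) f p)%E; last first.
  apply: eq_measure_integral => A mA Asq; rewrite -/nu coord_pair_law//.
  by rewrite /rho /= /mrestr setIidl.
rewrite [RHS](ge0_integral_pushforward measurable_coord_pair mu)//; last 2 first.
- exact: measurable_unit_square.
- by move=> p; rewrite inE; exact: f0.
have mpre : measurable (coord_pair @^-1` @unit_square R).
  rewrite -[X in measurable X]setTI; apply: measurable_coord_pair => //.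
  exact: measurable_unit_square.
have pcub x : @unit_cube R v x -> unit_square (coord_pair x).
  by move=> xc; split; exact: xc.
have mN : measurable (~` @unit_cube R v) by apply: measurableC; exact: measurable_unit_cube.
(* The preimage of the square may be larger than the cube, but [mu] does not charge the complement
   of the cube. *)
rewrite (@ge0_negligible_integral _ _ _ mu _ (~` @unit_cube R v))//.
- have -> : (coord_pair @^-1` unit_square) `\` (~` @unit_cube R v) = @unit_cube R v.
    by rewrite setDE setCK; apply/setIidr.
  apply: eq_measure_integral => A mA Ac.
  by rewrite /mu /= /mrestr setIidl.
- apply: (@measurable_comp _ _ _ _ _ _ (@unit_square R)) => //.
  + exact: measurable_unit_square.
  + by move=> _ [x + <-].
  exact: measurable_funTS measurable_coord_pair.
- by move=> x; exact: f0.
- by rewrite /mu /= /mrestr setICl measure0.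
Qed.

End Marginal.
End BoxMeasure.

(** * Estimates for graphons *)

Section BoundedIntegral.
Context d (T : measurableType d) (R : realType) (mu : {measure set T -> \bar R}).
Variable D : set T.
Hypotheses (mD : measurable D) (muD : (mu D < +oo)%E).

Lemma le_norm_integrable (f : T -> R) (M : R) : measurable_fun D f ->
  (forall x, D x -> `|f x| <= M) -> mu.-integrable D (EFin \o f).
Proof.
move=> mf fM; apply: measurable_bounded_integrable => //.
exists M; split; first exact: num_real.
by move=> y My x Dx; apply: le_trans (fM x Dx) (ltW My).
Qed.

(** The two conclusions are proved together, since additivity at each step needs integrability of
    the remaining sum. *)
Lemma Rintegral_sum (I : eqType) (s : seq I) (f : I -> T -> R) :
  (forall i, i \in s -> mu.-integrable D (EFin \o f i)) ->
  mu.-integrable D (EFin \o (fun x => \sum_(i <- s) f i x)) /\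
  \int[mu]_(x in D) (\sum_(i <- s) f i x) = \sum_(i <- s) \int[mu]_(x in D) f i x.
Proof.
elim: s => [_|i s ih h].
  split; last by under eq_Rintegral do rewrite big_nil; rewrite Rintegral_cst// mul0r big_nil.
  apply: (@le_norm_integrable _ 0) => [|x _]; last by rewrite big_nil normr0.
  by under eq_fun do rewrite big_nil; exact: measurable_cst.
have [] := ih; first by move=> k ks; apply: h; rewrite inE ks orbT.
move=> is_ es; have ii := h i (mem_head _ _).
have E : (fun x => \sum_(k <- i :: s) f k x) = (fun x => f i x + \sum_(k <- s) f k x).
  by apply/funext => x; rewrite big_cons.
rewrite E; split; last by rewrite RintegralD// es big_cons.
exact: (integrableD mD ii is_).
Qed.

End BoundedIntegral.

Section GraphonBounds.
Context {R : realType}.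
Local Notation bR := (measurableTypeR R).
Local Notation lam := (@lebesgue_measure R).
Local Notation lam2 := (lam \x lam)%E.
Implicit Types h : bR * bR -> R.

Lemma unit_square_lty : (lam2 (@unit_square R) < +oo)%E.
Proof. by rewrite measure_unit_square ltry. Qed.

Lemma unit_cube_lty v : (tuple_lebesgue v (@unit_cube R v) < +oo)%E.
Proof. by rewrite tuple_lebesgue_unit_cube ltry. Qed.

Lemma Rintegral_unit_cube_cst v (c : R) :
  \int[tuple_lebesgue v]_(x in @unit_cube R v) c = c.
Proof.
rewrite Rintegral_cst; last exact: measurable_unit_cube.
transitivity (c * 1); last exact: mulr1.
by congr (_ * _); exact (congr1 fine (tuple_lebesgue_unit_cube v)).
Qed.

Lemma square_integral_cst (c : R) : square_integral (fun=> c) = c.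
Proof.
rewrite /square_integral Rintegral_cst; last exact: measurable_unit_square.
transitivity (c * 1); last exact: mulr1.
by congr (_ * _); exact (congr1 fine measure_unit_square).
Qed.

(** [I_fun] is nonpositive on [0,1], and at [e = 2^-1] the linear term of [I_fun_ge] vanishes, so
    the minimum is there. *)
Lemma I_fun_norm_le (u : R) : 0 <= u <= 1 -> `|I_fun u| <= - I_fun 2^-1.
Proof.
move=> u01; have /andP[u0 u1] := u01.
have I0 : I_fun u <= 0.
  rewrite /I_fun -[leRHS]addr0; apply: lerD; apply: mulr_ge0_le0 => //; rewrite ?subr_ge0//.
    exact: ln_le0.
  by apply: ln_le0; rewrite lerBlDr lerDl.
rewrite ler0_norm// lerN2.
have h2 : 0 < (2^-1 : R) < 1 by rewrite invr_gt0 ltr0n invf_lt1 ?ltr1n// ltr0n.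
have := I_fun_ge u01 h2.
have -> : 1 - 2^-1 = 2^-1 :> R by lra.
have := sqr_ge0 (u - 2^-1); lra.
Qed.

Lemma measurable_I_fun : measurable_fun setT (@I_fun R).
Proof.
have m1x : measurable_fun setT (fun x : R => 1 - x) by exact: measurable_funB.
apply: measurable_funD; apply: measurable_funM => //.
by apply: measurableT_comp.
Qed.

Lemma square_integral_coord v (i j : 'I_v) (f : bR * bR -> R) : i != j ->
  measurable_fun unit_square f -> (forall p, unit_square p -> 0 <= f p) ->
  \int[tuple_lebesgue v]_(x in @unit_cube R v) f (tnth x i, tnth x j) =
  square_integral f.
Proof.
move=> ij mf f0; rewrite /square_integral /Rintegral; congr fine.
rewrite (ge0_integral_coord_pair ij (f := EFin \o f))//.
exact/measurable_EFinP.
Qed.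

Lemma unit_cube_coord v (i j : 'I_v) (x : v.-tuple bR) :
  unit_cube x -> unit_square (tnth x i, tnth x j).
Proof. by move=> xc; split; exact: xc. Qed.

Lemma measurable_coord v (i j : 'I_v) (f : bR * bR -> R) :
  measurable_fun unit_square f ->
  measurable_fun (@unit_cube R v) (fun x => f (tnth x i, tnth x j)).
Proof.
move=> mf; apply: (@measurable_comp _ _ _ _ _ _ (@unit_square R) f) => //.
- exact: measurable_unit_square.
- by move=> _ [x xc <-]; exact: unit_cube_coord.
- exact: measurable_funTS (measurable_coord_pair i j).
Qed.

Section FixedGraph.
Variables (v : nat) (H : sgraph v).

Lemma edges_neq (p : 'I_v * 'I_v) : p \in edges H -> p.1 != p.2.
Proof. by rewrite inE => /andP[+ _]; apply: contraTneq => ->; rewrite ltnn. Qed.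

Lemma hom_density_integrable h : graphon h ->
  (tuple_lebesgue v).-integrable (@unit_cube R v)
    (EFin \o (fun x => \prod_(p in edges H) h (tnth x p.1, tnth x p.2))).
Proof.
move=> [mh h01 _]; apply: (@le_norm_integrable _ _ _ _ _ _ _ _ 1).
- exact: measurable_unit_cube.
- exact: unit_cube_lty.
- under eq_fun do rewrite -big_enum /=.
  by apply: measurable_prod => p _; exact: measurable_coord.
- move=> x xc; have xh p := h01 _ (unit_cube_coord p.1 p.2 xc).
  rewrite ger0_norm; first by apply: prodr_ile1.
  by apply: prodr_ge0 => p _; case/andP: (xh p).
Qed.

(** Integrate [prod_le_second_order] over the cube. The endpoints of an edge are distinct, so each
    edge term becomes an integral over the unit square, where the linear parts cancel. *)
Lemma hom_density_le_second_order (e : R) : 0 <= e <= 1 ->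
  exists2 K : R, 0 <= K & forall h, graphon h -> square_integral h = e ->
  hom_density H h <=
  e ^+ #|edges H| + K * square_integral (fun p => (h p - e) ^+ 2).
Proof.
move=> e01; have [K K0 prodK] := prod_le_second_order #|edges H| e01.
exists (K * #|edges H|%:R) => [|h gh he]; first by rewrite mulr_ge0.
have [mh h01 _] := gh.
set n := #|edges H| in prodK *; pose E := enum (edges H).
have En : size E = n by rewrite -cardE.
(* The linear term uses [h p] instead of [h p - e], with the difference moved into [C], because
   [square_integral_coord] applies to nonnegative integrands. *)
pose g p := e ^+ n.-1 * h p + K * (h p - e) ^+ 2.
pose C := e ^+ n - e ^+ n.-1 * (n%:R * e).
have mg2 : measurable_fun unit_square (fun p => (h p - e) ^+ 2).
  by apply: measurable_funX; exact: measurable_funB.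
have mcube := @measurable_unit_cube R v.
have ih (p : 'I_v * 'I_v) : (tuple_lebesgue v).-integrable (@unit_cube R v)
    (EFin \o (fun x => h (tnth x p.1, tnth x p.2))).
  apply: (le_norm_integrable mcube (unit_cube_lty v) (M := 1)) => //.
    exact: measurable_coord.
  move=> x xc; have /andP[h0 h1] := h01 _ (unit_cube_coord p.1 p.2 xc).
  by rewrite ger0_norm.
have ih2 (p : 'I_v * 'I_v) : (tuple_lebesgue v).-integrable (@unit_cube R v)
    (EFin \o (fun x => (h (tnth x p.1, tnth x p.2) - e) ^+ 2)).
  apply: (le_norm_integrable mcube (unit_cube_lty v) (M := 1)) => //.
    exact: (measurable_coord _ _ mg2).
  move=> x xc; have /andP[h0 h1] := h01 _ (unit_cube_coord p.1 p.2 xc).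
  by rewrite ger0_norm ?sqr_ge0//; move: e01 => /andP[? ?]; nra.
have ig p : (tuple_lebesgue v).-integrable (@unit_cube R v)
    (EFin \o (fun x => g (tnth x p.1, tnth x p.2))).
  have := integrableD mcube (integrableZl mcube (e ^+ n.-1) (ih p))
    (integrableZl mcube K (ih2 p)).
  by apply: eq_integrable => // x _; rewrite /= -!EFinM -EFinD.
have [isum esum] := @Rintegral_sum _ _ _ _ _ mcube (unit_cube_lty v) _ E
  (fun p x => g (tnth x p.1, tnth x p.2)) (fun p _ => ig p).
have iC : (tuple_lebesgue v).-integrable (@unit_cube R v) (EFin \o (fun=> C)).
  by apply: (le_norm_integrable mcube (unit_cube_lty v) (M := `|C|)).
apply: (@le_trans _ _ (\int[tuple_lebesgue v]_(x in @unit_cube R v)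
   (C + \sum_(p <- E) g (tnth x p.1, tnth x p.2)))).
  apply: le_Rintegral => //.
  - exact: hom_density_integrable.
  - have := integrableD mcube iC isum.
    by apply: eq_integrable => // x _; rewrite /= -EFinD.
  - move=> x xc; rewrite -big_enum /=.
    apply: (le_trans (prodK _ E _ En _)).
      by move=> p; apply: h01; exact: unit_cube_coord.
    rewrite /g sumrB big_split /= -!mulr_sumr big_const_seq count_predT En iter_addr_0.
    by rewrite /C -mulr_natl; lra.
rewrite RintegralD// Rintegral_unit_cube_cst esum.
rewrite (eq_big_seq (fun=> e ^+ n.-1 * e + K * square_integral (fun p => (h p - e) ^+ 2))).
  rewrite big_const_seq count_predT En iter_addr_0 /C -mulr_natl; lra.
move=> p; rewrite mem_enum => /edges_neq pne; rewrite /g.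
rewrite RintegralD//; last 2 first.
- by have := integrableZl mcube (e ^+ n.-1) (ih p); apply: eq_integrable.
- by have := integrableZl mcube K (ih2 p); apply: eq_integrable.
rewrite !RintegralZl// (square_integral_coord pne mh); last by move=> q /h01 /andP[].
rewrite he; congr (_ + _ * _).
by rewrite (square_integral_coord pne mg2)// => q _; exact: sqr_ge0.
Qed.

(** Integrate [I_fun_ge]; its linear term vanishes because [h] has mean [e]. *)
Lemma square_integral_I_fun_ge (e : R) h : 0 < e < 1 -> graphon h ->
  square_integral h = e ->
  I_fun e + 4^-1 * square_integral (fun p => (h p - e) ^+ 2) <=
  square_integral (@I_fun R \o h).
Proof.
move=> e01 [mh h01 _] he.
have msq := @measurable_unit_square R.
have mg2 : measurable_fun unit_square (fun p => (h p - e) ^+ 2).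
  by apply: measurable_funX; exact: measurable_funB.
have ih : lam2.-integrable (@unit_square R) (EFin \o h).
  apply: (le_norm_integrable msq unit_square_lty (M := 1)) => // p /h01 /andP[h0 h1].
  by rewrite ger0_norm.
have ih2 : lam2.-integrable (@unit_square R) (EFin \o (fun p => (h p - e) ^+ 2)).
  apply: (le_norm_integrable msq unit_square_lty (M := 1)) => // p /h01 /andP[h0 h1].
  by rewrite ger0_norm ?sqr_ge0//; move: e01 => /andP[? ?]; nra.
have icst (c : R) : lam2.-integrable (@unit_square R) (EFin \o (fun=> c)).
  by apply: (le_norm_integrable msq unit_square_lty (M := `|c|)).
have iI : lam2.-integrable (@unit_square R) (EFin \o (@I_fun R \o h)).
  apply: (le_norm_integrable msq unit_square_lty (M := (- I_fun 2^-1))) => //.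
    exact: measurableT_comp measurable_I_fun mh.
  by move=> p /h01; exact: I_fun_norm_le.
set c := ln e - ln (1 - e).
pose C := I_fun e - c * e.
have i1 : lam2.-integrable (@unit_square R) (EFin \o (fun p => c * h p)).
  by have := integrableZl msq c ih; apply: eq_integrable.
have i2 : lam2.-integrable (@unit_square R) (EFin \o (fun p => 4^-1 * (h p - e) ^+ 2)).
  by have := integrableZl msq 4^-1 ih2; apply: eq_integrable.
have i12 : lam2.-integrable (@unit_square R)
    (EFin \o (fun p => c * h p + 4^-1 * (h p - e) ^+ 2)).
  by have := integrableD msq i1 i2; apply: eq_integrable.
apply: (@le_trans _ _ (square_integral (fun p => C +
   (c * h p + 4^-1 * (h p - e) ^+ 2)))).
  rewrite /square_integral (RintegralD msq (icst C) i12) (RintegralD msq i1 i2).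
  rewrite (RintegralZl _ msq ih) (RintegralZl _ msq ih2).
  rewrite -/(square_integral (fun=> C)) square_integral_cst -/(square_integral h) he.
  by rewrite -/(square_integral (fun p => (h p - e) ^+ 2)) /C; lra.
apply: le_Rintegral => //.
  by have := integrableD msq (icst C) i12; apply: eq_integrable.
move=> p /h01 hp; apply: le_trans (I_fun_ge hp e01); rewrite /C -/c; lra.
Qed.

End FixedGraph.
End GraphonBounds.

(** * Bounds on [psi] at fixed edge density *)

Section ConstrainedMaximum.
Context {R : realType}.
Local Notation bR := (measurableTypeR R).
Local Notation lam := (@lebesgue_measure R).
Local Notation lam2 := (lam \x lam)%E.
Variables (v : nat) (H : sgraph v) (e : R).
Hypothesis e01 : 0 < e < 1.
Local Notation n := #|edges H|.

Let admissible := [set h : bR * bR -> R | graphon h /\ square_integral h = e].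
Let value (b : R) (h : bR * bR -> R) :=
  b * hom_density H h - 2^-1 * square_integral (@I_fun R \o h).

Lemma graphon_cst : admissible (fun=> e).
Proof.
split; last exact: square_integral_cst.
by split => // p _; case/andP: e01 => *; rewrite !ltW.
Qed.

Lemma value_cst b : value b (fun=> e) = e ^+ n * b + - (2^-1 * I_fun e).
Proof.
rewrite /value -[(@I_fun R) \o _]/((fun=> I_fun e) : bR * bR -> R) square_integral_cst.
by rewrite /hom_density prodr_const Rintegral_unit_cube_cst mulrC.
Qed.

Lemma hom_density_le1 (h : bR * bR -> R) : graphon h -> hom_density H h <= 1.
Proof.
move=> gh; rewrite -(@Rintegral_unit_cube_cst R v 1).
apply: le_Rintegral => //.
- exact: measurable_unit_cube.
- exact: hom_density_integrable.
- apply: (le_norm_integrable (@measurable_unit_cube R v) (unit_cube_lty v) (M := 1)) => //.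
  by move=> x _; rewrite normr1.
- case: gh => _ h01 _ x xc; apply: prodr_ile1 => p _; exact/h01/unit_cube_coord.
Qed.

Lemma square_integral_sqr_ge0 (h : bR * bR -> R) :
  0 <= square_integral (fun p => (h p - e) ^+ 2).
Proof. by apply: Rintegral_ge0 => p _; exact: sqr_ge0. Qed.

(** Boundedness is what makes the real-valued [sup] in [psi] dominate every admissible value. *)
Lemma value_has_ubound b : 0 < b -> has_ubound [set value b h | h in admissible].
Proof.
move=> b0; exists (b - 2^-1 * I_fun e) => _ [h [gh he] <-]; rewrite /value.
have := square_integral_I_fun_ge e01 gh he.
have := square_integral_sqr_ge0 h; have := hom_density_le1 gh.
rewrite -(ler_pM2l b0) mulr1; lra.
Qed.

Lemma psi_ge b h : 0 < b -> admissible h -> value b h <= psi H e b.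
Proof. by move=> b0 ah; apply: ub_le_sup; [exact: value_has_ubound|exists h]. Qed.

Lemma psi_affine_small : exists2 b0, 0 < b0 &
  forall b, 0 < b <= b0 -> psi H e b = e ^+ n * b + - (2^-1 * I_fun e).
Proof.
have e01' : 0 <= e <= 1 by case/andP: e01 => *; rewrite !ltW.
have [K K0 hK] := hom_density_le_second_order H e01'.
have K1 : 0 < 8 * (K + 1) by rewrite mulr_gt0// ltr_wpDl.
(* With [D] the squared distance to [e], the density term gains at most [b * K * D] and the entropy
   costs at least [D / 8], so [8 * K * b <= 1] suffices. *)
exists (8 * (K + 1))^-1; first by rewrite invr_gt0.
move=> b /andP[b0]; rewrite -[leRHS]mul1r ler_pdivlMr// => bK.
apply/eqP; rewrite eq_le; apply/andP; split; last first.
  by rewrite -value_cst; apply: psi_ge => //; exact: graphon_cst.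
apply: ge_sup; first by exists (value b (fun=> e)), (fun=> e) => //; exact: graphon_cst.
move=> _ [h [gh he] <-]; rewrite /value.
have := square_integral_I_fun_ge e01 gh he.
have := hK h gh he; rewrite -(ler_pM2l b0) mulrDr.
move: (square_integral_sqr_ge0 h); set D := square_integral (fun p => _) => D0.
have : (8 * K * b) * D <= 1 * D by rewrite ler_wpM2r//; lra.
lra.
Qed.

Let clique : bR * bR -> R :=
  \1_(`[0, Num.sqrt e]%classic `*` `[0, Num.sqrt e]%classic).

Lemma clique_admissible : admissible clique.
Proof.
have /andP[e0 e1] := e01.
have mc : measurable (`[0, Num.sqrt e]%classic `*` `[0, Num.sqrt e]%classic : set (bR * bR)).
  exact: measurableX.
have me : lam2 (`[0, Num.sqrt e]%classic `*` `[0, Num.sqrt e]%classic) = e%:E.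
  rewrite product_measure1E//= !lebesgue_measure_0b ?sqrtr_ge0//.
  by rewrite -EFinM -expr2 sqr_sqrtr// ltW.
split; [split|].
- exact: measurable_indic.
- by move=> p _; rewrite /clique indicE ler0n lern1 leq_b1.
- move=> x y _; rewrite /clique !indicE; congr ((nat_of_bool _)%:R).
  by apply/idP/idP; rewrite !inE => -[].
- have s1 : Num.sqrt e <= 1 by rewrite -[leRHS]sqrtr1 ler_wsqrtr// ltW.
  rewrite /square_integral /Rintegral integral_indic//; last exact: measurable_unit_square.
  rewrite setIidl; last first.
    move=> [x y] [/=]; rewrite !in_itv/= => /andP[x0 x1] /andP[y0 y1].
    by split; rewrite /= in_itv/= ?x0 ?y0 /= (le_trans _ s1).
  exact (congr1 fine me).
Qed.

(** When all coordinates lie in [[0, sqrt e]] every factor is 1, so the integrand dominates the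
    indicator of that box. Isolated vertices can make the inequality strict. *)
Lemma hom_density_clique : Num.sqrt e ^+ v <= hom_density H clique.
Proof.
have [gc _] := clique_admissible.
have /andP[e0 e1] := e01.
have s1 : Num.sqrt e <= 1 by rewrite -[leRHS]sqrtr1 ler_wsqrtr// ltW.
pose B : set (v.-tuple bR) := box (fun=> `[0, Num.sqrt e]%classic).
have mB : measurable B by exact: measurable_box.
have mcube := @measurable_unit_cube R v.
have -> : Num.sqrt e ^+ v = \int[tuple_lebesgue v]_(x in @unit_cube R v) (\1_B x).
  rewrite /Rintegral integral_indic// setIidl; last first.
    move=> x xB i; have := xB i; rewrite /= !in_itv/= => /andP[-> xs] /=.
    exact: le_trans xs s1.
  suff : tuple_lebesgue v B = (Num.sqrt e ^+ v)%:E.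
    by move=> BE; symmetry; exact (congr1 fine BE).
  rewrite (@tuple_lebesgue_box _ _ _ (fun=> Num.sqrt e))//.
    by rewrite prodr_const card_ord.
  by move=> _; rewrite lebesgue_measure_0b// sqrtr_ge0.
apply: le_Rintegral => //.
- apply: (le_norm_integrable mcube (unit_cube_lty v) (M := 1)) => //.
  by move=> x _; rewrite indicE ger0_norm ?ler0n// lern1 leq_b1.
- exact: hom_density_integrable.
- move=> x xc; rewrite indicE; case: (boolP (x \in B)) => [|_]; last first.
    apply: prodr_ge0 => p _; have [_ /(_ _ (unit_cube_coord p.1 p.2 xc))] := gc.
    by case/andP.
  rewrite inE => xB; rewrite big1// => p _.
  by rewrite /clique indicE mem_set//; split; exact: xB.
Qed.

Lemma psi_ge_clique b : 0 < b -> b * Num.sqrt e ^+ v <= psi H e b.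
Proof.
move=> b0; apply: le_trans (psi_ge b0 clique_admissible).
rewrite /value.
have -> : @I_fun R \o clique = fun=> 0.
  apply/funext => p /=; rewrite /clique indicE /I_fun.
  by case: (_ \in _); rewrite /= ?subrr ?subr0 ?ln1 ?mul0r ?mulr0 ?add0r ?addr0 ?mulr0.
rewrite square_integral_cst mulr0 subr0 ler_wpM2l ?(ltW b0)//.
exact: hom_density_clique.
Qed.

End ConstrainedMaximum.

(** * Failure of analyticity at the end of the affine range *)

Theorem mainTheorem8 (R : realType) (v : nat) (H : sgraph v) (eps : R)
    (hH : v%:R / 2 < #|edges H|%:R :> R)
    (heps0 : 0 < eps) (heps1 : eps < 1) :
  exists beta2 : R, 0 < beta2 /\
    ~ real_analytic_at (fun b : R => psi H eps b) beta2.
Proof.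
have e01 : 0 < eps < 1 by rewrite heps0.
set p := eps ^+ #|edges H|; set q := - (2^-1 * I_fun eps).
have [b0 b0_gt0 psib0] := psi_affine_small H e01.
pose S := [set b | 0 < b /\ forall x, 0 < x <= b -> psi H eps x = p * x + q].
have Sb0 : S b0 by [].
have gap : p < Num.sqrt eps ^+ v.
  have s0 : 0 < Num.sqrt eps by rewrite sqrtr_gt0.
  have s1 : Num.sqrt eps < 1 by rewrite -[ltRHS]sqrtr1 ltr_sqrt.
  have -> : p = Num.sqrt eps ^+ (2 * #|edges H|).
    by rewrite exprM sqr_sqrtr// ltW.
  rewrite ltr_iXn2l//.
  by move: hH; rewrite ltr_pdivrMr// mulrC -natrM ltr_nat.
(* For [b] in [S] the clique bound reads [b * sqrt eps ^+ v <= p * b + q]; solve for [b]. *)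
have ubS : ubound S (`|q| / (Num.sqrt eps ^+ v - p)).
  move=> b [bgt0 bS]; rewrite ler_pdivlMr ?subr_gt0//.
  have := psi_ge_clique H e01 bgt0; rewrite bS ?bgt0 ?lexx//.
  have := ler_norm q; lra.
have supS : has_sup S by split; [exists b0|exists (`|q| / (Num.sqrt eps ^+ v - p))].
set s := sup S.
have s0 : 0 < s by apply: (lt_le_trans b0_gt0); apply: ub_le_sup => //; case: supS.
(* Some element of [S] exceeds [x]. The value at [s] itself is left to the analytic continuation. *)
have psis x : 0 < x -> x < s -> psi H eps x = p * x + q.
  move=> x0 xs; have [|y [_ yS]] := @sup_adherent _ S (s - x) _ supS.
    by rewrite subr_gt0.
  by rewrite subKr => xy; apply: yS; rewrite x0 ltW.
exists s; split => // an.
have [|d d0 psid] := @analytic_affine_left _ _ s s p q s0 an.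
  by move=> x /andP[+ xs]; rewrite subrr => x0; exact: psis.
(* Halving [d] keeps the closed right end inside the open interval where [psid] applies. *)
suff : S (s + d / 2).
  move=> /(ub_le_sup supS.2); rewrite -/s gerDl leNgt divr_gt0//.
split; first by rewrite addr_gt0// divr_gt0.
move=> x /andP[x0 xs]; have [xlts|slex] := ltP x s; first exact: psis.
apply: psid; rewrite ger0_norm ?subr_ge0//.
have : d / 2 < d by rewrite ltr_pdivrMr// ltr_pMr// ltr1n.
lra.
Qed.
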